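(* Let $P,Q\subseteq\mathbb R^D$ be nonempty polyhedra. Then $$1-\frac{1}{\kappa_*^2}\le\max_{x,y}\,c_F\bigl(\mathrm{aff}_0(P_x),\mathrm{aff}_0(Q_y)\bigr)^2,$$ where the maximum is over all $x,y\in\mathbb R^D$ for which the faces $P_x$ and $Q_y$ are nonempty.
   Context: A polyhedron is an intersection of finitely many closed halfspaces. $d(K_1,K_2)=\inf\{\|k_1-k_2\|: k_1\in K_1,k_2\in K_2\}$ and $d(x,K)=d(\{x\},K)$. Let $E=\{p\in P: d(p,Q)=d(P,Q)\}$, let $v=\Pi_{Q-P}0$ be the minimum-norm element of $Q-P=\{q-p: q\in Q,p\in P\}$, and let $Q'=Q-v$. For $x\in\mathbb R^D\setminus E$ let $$\kappa(x)=\frac{d(x,E)}{\max\{d(x,P),d(x,Q')\}},$$ and let $\kappa_*=\sup_{x\in(P\cup Q')\setminus E}\kappa(x)$ (with $\kappa_*=1$ if $(P\cup Q')\setminus E=\emptyset$, and $1/\kappa_*^2=0$ if $\kappa_*=\infty$). The faces of a polyhedron $P$ are the nonempty sets $P_x=\arg\max_{p\in P}x^\top p$, $x\in\mathbb R^D$. For a nonempty set $C$, $\mathrm{aff}_0(C)=\mathrm{aff}(C)-c$ for any $c\in C$, where $\mathrm{aff}(C)$ is the affine hull. For subspaces $U,W$ of $\mathbb R^D$, the cosine of the Friedrichs angle is $$c_F(U,W)=\sup\{u^\top w: u\in U\cap(U\cap W)^\perp,\ w\in W\cap(U\cap W)^\perp,\ \|u\|\le1,\ \|w\|\le1\}.$$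 *)

(* Defs.v *)
(* Points of R^D are row vectors. *)
From HB Require Import structures.
From mathcomp Require Import all_boot all_order all_algebra.
From mathcomp Require Import all_classical all_reals all_analysis.

Set Implicit Arguments.
Unset Strict Implicit.
Unset Printing Implicit Defensive.

Import Order.TTheory GRing.Theory Num.Theory.
Local Open Scope classical_set_scope.
Local Open Scope ring_scope.

Section Definitions.
Context {R : realType} {D : nat}.
Implicit Types (x y u w c : 'rV[R]_D) (A B C H K P Q U W : set 'rV[R]_D).

Definition dot x y : R := \sum_(i < D) x 0 i * y 0 i.

(* The norm `|x| that the library puts on matrices is the sup norm, hence
   this separate Euclidean norm. *)
Definition enorm x : R := Num.sqrt (dot x x).

Definition closed_halfspace H :=
  exists a (b : R), a != 0 /\ H = [set x | dot a x <= b].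

Definition polyhedron P :=
  exists m (H : 'I_m -> set 'rV[R]_D),
    (forall i, closed_halfspace (H i)) /\ P = \bigcap_i H i.

Definition set_dist A B : R := inf [set enorm (a - b) | a in A & b in B].

Definition pt_dist x A : R := set_dist [set x] A.

(* Pi_K x, a point of K nearest to x; it exists and is unique when K is
   nonempty, closed and convex, and 0 is a junk value when no nearest point
   exists. *)
Definition proj K x : 'rV[R]_D :=
  xget 0 [set y | K y /\ forall z, K z -> enorm (x - y) <= enorm (x - z)].

Definition gap_vec P Q : 'rV[R]_D := proj [set q - p | q in Q & p in P] 0.

Definition nearest_pts P Q : set 'rV[R]_D :=
  [set p | P p /\ pt_dist p Q = set_dist P Q].

Definition shifted P Q : set 'rV[R]_D := [set q - gap_vec P Q | q in Q].

(* Only meaningful for x outside E = nearest_pts P Q. *)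
Definition kappa P Q x : R :=
  pt_dist x (nearest_pts P Q) /
    Num.max (pt_dist x P) (pt_dist x (shifted P Q)).

Definition kappa_dom P Q : set 'rV[R]_D :=
  (P `|` shifted P Q) `\` nearest_pts P Q.

Definition kappa_star P Q : \bar R :=
  if kappa_dom P Q == set0 then 1%E
  else ereal_sup [set (kappa P Q x)%:E | x in kappa_dom P Q].

Definition face P x : set 'rV[R]_D :=
  [set p | P p /\ forall p', P p' -> dot x p' <= dot x p].

Definition aff C : set 'rV[R]_D :=
  [set x | exists n (l : 'I_n -> R) (c : 'I_n -> 'rV[R]_D),
     [/\ forall i, C (c i), \sum_i l i = 1 & x = \sum_i l i *: c i]].

(* The translates aff C - c, for c in C, all coincide (lemma aff0E), so that
   their union is aff C - c for any c in C. *)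
Definition aff0 C : set 'rV[R]_D := [set a - c | a in aff C & c in C].

Definition orth W : set 'rV[R]_D := [set u | forall w, W w -> dot u w = 0].

(* Meant for linear subspaces U and W. *)
Definition cosF U W : R :=
  sup [set dot u w | u in [set u | (U `&` orth (U `&` W)) u /\ enorm u <= 1]
                   & w in [set w | (W `&` orth (U `&` W)) w /\ enorm w <= 1]].

Definition is_max (S : set R) (M : R) := S M /\ ubound S M.

Lemma aff0E C c : C c -> aff0 C = [set a - c | a in aff C].
Proof.
move=> Cc; apply/seteqP; split=> [_ [a [n [l [f [Cf l1 ->]]]]] [c' Cc' <-]|].
  pose cons T (t : T) (g : 'I_n -> T) (i : 'I_n.+1) :=
    if unlift ord0 i is Some j then g j else t.
  pose cons' T (t : T) (g : 'I_n.+1 -> T) (i : 'I_n.+2) :=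
    if unlift ord0 i is Some j then g j else t.
  exists (\sum_i l i *: f i - c' + c); last by rewrite addrK.
  exists n.+2, (cons' R 1 (cons R (-1) l)).
  exists (cons' _ c (cons _ c' f)); split.
  - move=> i; rewrite /cons' /cons; case: unliftP => // j _.
    by case: unliftP.
  - rewrite !big_ord_recl /cons' /cons !unlift_none liftK unlift_none.
    by under eq_bigr do rewrite !liftK; rewrite l1 addrA subrr add0r.
  - rewrite !big_ord_recl /cons' /cons !unlift_none liftK unlift_none.
    under [in RHS]eq_bigr do rewrite !liftK.
    by rewrite scale1r scaleN1r [RHS]addrC [in RHS](addrC (- c')).
by move=> _ [a affa <-]; exists a => //; exists c.
Qed.

End Definitions.

(* Main.v *)
Require Import Defs.
From mathcomp Require Import all_boot all_order all_algebra.
From mathcomp Require Import all_classical all_reals all_analysis.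
From mathcomp Require Import ring lra.
Import Order.TTheory GRing.Theory Num.Theory.
Import numFieldNormedType.Exports.
Local Open Scope classical_set_scope.
Local Open Scope ring_scope.

(** Write [v] for the gap vector, [Q' = Q - v] and [E] for the set of points
    of [P] nearest to [Q].  When [E] is nonempty, [E = P `&` Q']
    (lemma [nearest_pts_shifted]), and the faces of [Q'] are translates of
    those of [Q].  So the matter is the following: given polyhedra [A] and
    [B] that meet and a point [x] of [A], find faces [F] of [A] and [G] of
    [B], with [c] the cosine of the Friedrichs angle of [U = aff0 F] and
    [W = aff0 G], such that
      [(1 - c^2) d(x, A `&` B)^2 <= d(x, B)^2]
    (lemma [sqr_pt_dist_cap]).  For [x] in [P] take [A = P] and [B = Q'], for
    [x] in [Q'] the other way round.

    Let [e] be the point of [A `&` B] nearest to [x].  Then [u = x - e] is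
    normal to [A `&` B] at [e], hence by Farkas' lemma [u = n + n'] with [n]
    normal to [A] and [n'] normal to [B] at [e].  Let [F] and [G] be the faces
    exposed by [n] and [n'].  The decomposition is chosen with [n'] as short as
    possible.  Since [n] and [n'] are relatively interior to the normal cones
    of [F] and [G] (lemma [face_relint]), a vector [h] in
    [U^perp `&` W^perp] may be moved from [n] to [n'] in small amounts of
    either sign, and minimality makes [n'] orthogonal to [h].  So [n'] is in
    [U + W] (lemma [orth_orthI_add]), and as [n] is orthogonal to [U] and
    [n'] to [W], the definition of the Friedrichs angle yields
      [(1 - c^2) |n'|^2 <= |u|^2]
    (lemma [cosF_sqr_norm_add]).  On the other hand [n . u <= 0] because [x] is
    in [A], and [n' . (y - e) <= 0] for [y] in [B]; therefore
    [|u|^2 <= n' . (x - y) <= |n'| |x - y|], that is, [|u|^2 <= |n'| d(x, B)].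
    The two inequalities together give the claim.

    The maximum over faces exists because a face is determined by the set of
    constraints that are tight on it (lemma [face_tight]). *)

Set Implicit Arguments.
Unset Strict Implicit.
Unset Printing Implicit Defensive.

(** * The Euclidean inner product *)

Section InnerProduct.
Context {R : realType} {D : nat}.
Implicit Types (x y z a u : 'rV[R]_D) (t : R).

Lemma dotC x y : dot x y = dot y x.
Proof. by rewrite /dot; apply: eq_bigr => i _; rewrite mulrC. Qed.

Lemma dotDl x y z : dot (x + y) z = dot x z + dot y z.
Proof.
by rewrite /dot -big_split; apply: eq_bigr => i _; rewrite mxE mulrDl.
Qed.

Lemma dotZl t x z : dot (t *: x) z = t * dot x z.
Proof. by rewrite /dot mulr_sumr; apply: eq_bigr => i _; rewrite mxE mulrA. Qed.

Lemma dotNl x z : dot (- x) z = - dot x z.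
Proof. by rewrite -scaleN1r dotZl mulN1r. Qed.

Lemma dotDr x y z : dot z (x + y) = dot z x + dot z y.
Proof. by rewrite !(dotC z) dotDl. Qed.

Lemma dotZr t x z : dot z (t *: x) = t * dot z x.
Proof. by rewrite !(dotC z) dotZl. Qed.

Lemma dotNr x z : dot z (- x) = - dot z x.
Proof. by rewrite !(dotC z) dotNl. Qed.

Lemma dot0l x : dot 0 x = 0.
Proof. by rewrite -(scale0r 0) dotZl mul0r. Qed.

Lemma dot0r x : dot x 0 = 0.
Proof. by rewrite dotC dot0l. Qed.

Definition dotE := (dotDl, dotDr, dotNl, dotNr, dotZl, dotZr, dot0l, dot0r).

Lemma dot_suml (I : finType) (P : pred I) (f : I -> 'rV[R]_D) z :
  dot (\sum_(i | P i) f i) z = \sum_(i | P i) dot (f i) z.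
Proof.
by elim/big_rec2: _ => [|i y1 y2 _ <-]; rewrite ?dot0l ?dotDl.
Qed.

Lemma dot_ge0 x : 0 <= dot x x.
Proof. by apply: sumr_ge0 => i _; rewrite -expr2 sqr_ge0. Qed.

Lemma dot_eq0 x : dot x x = 0 -> x = 0.
Proof.
move=> /eqP; rewrite psumr_eq0; last by move=> i _; rewrite -expr2 sqr_ge0.
move=> /allP x0; apply/rowP => i; rewrite mxE; apply/eqP.
by have := x0 i (mem_index_enum i); rewrite /= mulf_eq0 orbb.
Qed.

Lemma sqr_dot_le x y : dot x y ^+ 2 <= dot x x * dot y y.
Proof.
have [y0|yn0] := eqVneq (dot y y) 0.
  by rewrite (dot_eq0 y0) !dotE expr0n mulr0.
have yy : 0 < dot y y by rewrite lt_def yn0 dot_ge0.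
have := dot_ge0 (dot y y *: x - dot x y *: y).
rewrite !dotE (dotC y x) => h.
have {h} : 0 <= dot y y * (dot x x * dot y y - dot x y ^+ 2) by lra.
by rewrite pmulr_rge0// subr_ge0.
Qed.

Lemma enorm_ge0 x : 0 <= enorm x.
Proof. exact: sqrtr_ge0. Qed.

Lemma sqr_enorm x : enorm x ^+ 2 = dot x x.
Proof. by rewrite sqr_sqrtr ?dot_ge0. Qed.

Lemma dot_le_enorm x y : dot x y <= enorm x * enorm y.
Proof.
rewrite (le_trans (ler_norm _))// -sqrtr_sqr /enorm -sqrtrM ?dot_ge0//.
by rewrite ler_wsqrtr// sqr_dot_le.
Qed.

Lemma enormN x : enorm (- x) = enorm x.
Proof. by rewrite /enorm dotNl dotNr opprK. Qed.

Lemma enorm_eq0 x : enorm x = 0 -> x = 0.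
Proof. by move=> x0; apply: dot_eq0; rewrite -sqr_enorm x0 expr0n. Qed.

Lemma enormZ t x : 0 <= t -> enorm (t *: x) = t * enorm x.
Proof.
move=> t0; rewrite /enorm dotZl dotZr mulrA -expr2 sqrtrM ?sqr_ge0//.
by rewrite sqrtr_sqr ger0_norm.
Qed.

Lemma ler_enorm x y : (enorm x <= enorm y) = (dot x x <= dot y y).
Proof. by rewrite /enorm ler_sqrt ?dot_ge0. Qed.

Lemma enormB x y : enorm (x - y) = enorm (y - x).
Proof. by rewrite -enormN opprB. Qed.

(** Bartl's induction: unless [u . d <= 0] follows from the inequalities
    indexed by the tail, some [d] satisfies these and has [u . d > 0], hence
    [a j . d > 0].  Projecting [u] and every [a i] along [a j] onto the
    hyperplane orthogonal to [d] then reduces the claim to the tail. *)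
Lemma farkas_seq (I : eqType) (s : seq I) (a : I -> 'rV[R]_D) u :
    uniq s ->
    (forall d, (forall i, i \in s -> dot (a i) d <= 0) -> dot u d <= 0) ->
  exists l : I -> R, (forall i, 0 <= l i) /\ u = \sum_(i <- s) l i *: a i.
Proof.
elim: s a u => [|j s IH] a u /=.
  move=> _ H; exists (fun=> 0); split=> //; rewrite big_nil.
  by apply: dot_eq0; apply/eqP; rewrite eq_le dot_ge0 H.
move=> /andP[js us] H.
have extend (l : I -> R) (c : R) (w : 'rV[R]_D) :
    (forall i, 0 <= l i) -> 0 <= c -> w = \sum_(i <- s) l i *: a i ->
    exists k : I -> R, (forall i, 0 <= k i) /\
      w + c *: a j = \sum_(i <- j :: s) k i *: a i.
  move=> l0 c0 ->; exists (fun i => if i == j then c else l i).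
  split=> [i|]; first by case: eqP.
  rewrite big_cons eqxx addrC; congr (_ + _).
  by apply: eq_big_seq => i si; case: eqP => // ij; rewrite -ij si in js.
have [Hs|] := pselect
    (forall d, (forall i, i \in s -> dot (a i) d <= 0) -> dot u d <= 0).
  have [l [l0 ul]] := IH a u us Hs.
  by have := extend l 0 u l0 (lexx _) ul; rewrite scale0r addr0.
move=> /existsNP[d /not_implyP[sd /negP]]; rewrite -ltNge => ud.
have ajd : 0 < dot (a j) d.
  rewrite ltNge; apply/negP => ajd; move: ud; rewrite ltNge => /negP; apply.
  by apply: H => i; rewrite inE => /orP[/eqP->|/sd].
pose c := (dot (a j) d)^-1; have c0 : 0 < c by rewrite invr_gt0.
have cd : c * dot (a j) d = 1 by rewrite mulVf// gt_eqF.
pose pr w : 'rV[R]_D := w - (c * dot w d) *: a j.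
have [e es|l [l0 ul]] := IH (pr \o a) (pr u) us.
  have -> : dot (pr u) e = dot u (e - (c * dot (a j) e) *: d).
    by rewrite /pr !dotE; ring.
  apply: H => i; rewrite inE => /orP[/eqP->|si].
    have -> : dot (a j) (e - (c * dot (a j) e) *: d) =
              dot (a j) e * (1 - c * dot (a j) d) by rewrite !dotE; ring.
    by rewrite cd subrr mulr0.
  have := es i si; rewrite /= /pr !dotE; lra.
pose k := c * dot u d - \sum_(i <- s) l i * (c * dot (a i) d).
have -> : u = \sum_(i <- s) l i *: a i + k *: a j.
  have -> : u = pr u + (c * dot u d) *: a j by rewrite /pr subrK.
  rewrite ul; under eq_bigr do rewrite /= /pr scalerBr scalerA.
  by rewrite sumrB -scaler_suml /k scalerBl -addrA (addrC (- _)).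
apply: (extend l) => //; rewrite /k subr_ge0.
apply: (@le_trans _ _ 0); last by rewrite mulr_ge0// ltW.
rewrite big_seq; apply: sumr_le0 => i si.
by rewrite mulr_ge0_le0// pmulr_rle0// sd.
Qed.

Lemma farkas (I : finType) (P : pred I) (a : I -> 'rV[R]_D) u :
    (forall d, (forall i, P i -> dot (a i) d <= 0) -> dot u d <= 0) ->
  exists l : I -> R, (forall i, 0 <= l i) /\ u = \sum_(i | P i) l i *: a i.
Proof.
move=> H.
have [d Hd|l [l0 ->]] := @farkas_seq I (enum P) a u (enum_uniq P).
  by apply: H => i Pi; apply: Hd; rewrite mem_enum.
by exists l; split=> //; rewrite big_enum.
Qed.

End InnerProduct.

(** * Nearest points *)

Section NearestPoint.
Context {R : realType} {D : nat}.
Implicit Types (x y z a : 'rV[R]_D) (K : set 'rV[R]_D).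

Lemma continuous_dotr a : continuous (dot a).
Proof.
have c i : continuous (fun y : 'rV[R]_D => a 0 i * y 0 i).
  move=> y; apply: (@continuousM _ _ (cst (a 0 i)) (fun y : 'rV[R]_D => y 0 i)).
    exact: cst_continuous.
  exact: coord_continuous.
exact: (continuous_big (P := xpredT) add_continuous (fun i _ => c i)).
Qed.

Lemma continuous_sqr_dist x : continuous (fun y => dot (x - y) (x - y)).
Proof.
have c i : continuous (fun y : 'rV[R]_D => (x - y) 0 i).
  have -> : (fun y : 'rV[R]_D => (x - y) 0 i) = (fun y => x 0 i - y 0 i).
    by apply/funext => y; rewrite !mxE.
  move=> y.
  apply: (@continuousB _ _ _ (cst (x 0 i)) (fun y : 'rV[R]_D => y 0 i)).
    exact: cst_continuous.
  exact: coord_continuous.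
have cc i : continuous (fun y : 'rV[R]_D => (x - y) 0 i * (x - y) 0 i).
  by move=> y; apply: continuousM; exact: c.
exact: (continuous_big (P := xpredT) add_continuous (fun i _ => cc i)).
Qed.

Lemma closed_dot_le a (b : R) : closed [set x | dot a x <= b].
Proof.
exact: (continuous_closedP (dot a)).1 (@continuous_dotr a) _ (@closed_le R b).
Qed.

Lemma coord_le_enorm x i : `|x 0 i| <= enorm x.
Proof.
rewrite -sqrtr_sqr ler_wsqrtr// /dot (bigD1 i)//= -expr2 lerDl.
by apply: sumr_ge0 => j _; rewrite -expr2 sqr_ge0.
Qed.

Lemma nearest_point K x : closed K -> K !=set0 ->
  exists2 y, K y & forall z, K z -> enorm (x - y) <= enorm (x - z).
Proof.
move=> cK [z0 Kz0]; pose r := enorm (x - z0).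
pose box := [set v : 'rV[R]_D |
  forall i, (v ord0 i) \in `[x 0 i - r, x 0 i + r]].
have inbox z : enorm (x - z) <= r -> box z.
  move=> zr i; have := le_trans (coord_le_enorm (x - z) i) zr.
  by rewrite !mxE in_itv /= ler_norml => /andP[? ?]; apply/andP; split; lra.
have cC : compact (K `&` box).
  have bc : compact box.
    apply: (@rV_compact R^o D (fun i => `[x 0 i - r, x 0 i + r]%classic)) => i.
    exact: segment_compact.
  rewrite setIC; exact: compact_closedI.
have C0 : K `&` box !=set0 by exists z0; split=> //; exact: inbox.
(* A nearest point in the box of half-width [r] around [x] is nearest in all of
   [K], since points outside the box are farther from [x] than [z0]. *)
have [y] := EVT_min_rV C0 cC (continuous_subspaceT (@continuous_sqr_dist x)).
rewrite inE => -[Ky _] ymin; exists y => // z Kz; rewrite ler_enorm.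
have [zr|rz] := leP (enorm (x - z)) r.
  by apply: ymin; rewrite inE; split=> //; exact: inbox.
apply: (@le_trans _ _ (dot (x - z0) (x - z0))).
  by apply: ymin; rewrite inE; split=> //; exact: inbox.
by rewrite -ler_enorm ltW.
Qed.

(** Along the segment from [y] to [z] the squared distance to [x] is a
    quadratic in the parameter with derivative [- 2 (x - y) . (z - y)] at
    [y]. *)
Lemma nearest_obtuse K x y z :
    (forall t, 0 <= t <= 1 -> K (y + t *: (z - y))) ->
    (forall w, K w -> enorm (x - y) <= enorm (x - w)) ->
  dot (x - y) (z - y) <= 0.
Proof.
move=> Kyz ymin; rewrite leNgt; apply/negP => p0.
set p := dot _ _ in p0; set q := dot (z - y) (z - y).
have q0 : 0 <= q := dot_ge0 _.
(* At this parameter the linear decrease outweighs the quadratic term. *)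
pose t := p / (p + q).
have tpq : t * (p + q) = p by rewrite mulfVK// gt_eqF// ltr_wpDr.
have t01 : 0 <= t <= 1.
  by rewrite divr_ge0 ?ler_pdivrMr ?mul1r ?lerDl ?addr_ge0 ?ltr_wpDr// ltW.
have := ymin _ (Kyz t t01); rewrite ler_enorm.
have -> : x - (y + t *: (z - y)) = (x - y) - t *: (z - y).
  by rewrite opprD addrA.
rewrite !(dotDl (x - y)) !(dotDr (x - y)) !dotNl !dotNr !dotZl !dotZr.
rewrite (dotC (z - y) (x - y)) -/p -/q => h.
have {h} : 0 <= t * (t * q - 2 * p) by lra.
have t0 : 0 < t by rewrite divr_gt0// ltr_wpDr.
rewrite pmulr_rge0//; nra.
Qed.
End NearestPoint.

Section Subspaces.
Context {R : realType} {D : nat}.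
Implicit Types (x y z u v w : 'rV[R]_D) (U V W : set 'rV[R]_D).

Definition linspace U := U 0 /\ forall t u v, U u -> U v -> U (t *: u + v).

Lemma linspaceD U u v : linspace U -> U u -> U v -> U (u + v).
Proof. by move=> [_ lU] Uu Uv; rewrite -[u]scale1r; apply: lU. Qed.

Lemma linspaceZ U t u : linspace U -> U u -> U (t *: u).
Proof. by move=> [U0 lU] Uu; rewrite -[_ *: _]addr0; apply: lU. Qed.

Lemma linspaceN U u : linspace U -> U u -> U (- u).
Proof. by move=> sU Uu; rewrite -scaleN1r; apply: linspaceZ. Qed.

Lemma linspaceB U u v : linspace U -> U u -> U v -> U (u - v).
Proof. by move=> sU Uu Uv; rewrite -scaleN1r addrC; apply: sU.2. Qed.

Lemma linspaceI U W : linspace U -> linspace W -> linspace (U `&` W).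
Proof.
move=> [U0 lU] [W0 lW]; split=> // t u v [? ?] [? ?].
by split; [apply: lU|apply: lW].
Qed.

Lemma linspace_orth U : linspace (orth U).
Proof.
split=> [w _|t u v uU vU w Uw]; first by rewrite dot0l.
by rewrite !dotE uU// vU// mulr0 addr0.
Qed.

Lemma linspace_row m U (M : 'M[R]_(m, D)) :
  linspace U -> (forall i, U (row i M)) -> forall u, (u <= M)%MS -> U u.
Proof.
move=> sU UM u /submxP[c ->]; rewrite mulmx_sum_row.
elim/big_ind: _ => [|a b|i _]; first exact: sU.1.
- exact: linspaceD.
- exact: linspaceZ.
Qed.

(** A matrix of maximal rank among those with all rows in the subspace. *)
Lemma linspace_mx U : linspace U ->
  exists M : 'M[R]_D, forall u, U u <-> (u <= M)%MS.
Proof.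
move=> sU.
pose rk k := `[< exists2 M : 'M[R]_D, (forall i, U (row i M)) & \rank M = k >].
have rk0 : exists k, rk k.
  exists 0%N; apply/asboolP; exists 0; last exact: mxrank0.
  by move=> i; rewrite row0; exact: sU.1.
have rkD k : rk k -> (k <= D)%N.
  by move=> /asboolP[M _ <-]; exact: rank_leq_row.
have [k /asboolP[M UM rM] kmax] := ex_maxnP rk0 rkD.
exists M => u; split; last exact: linspace_row.
move=> Uu; apply: contraT => uM.
have /kmax : rk (\rank (M + u)%MS).
  apply/asboolP; exists (M + u)%MS => // i.
  have /sub_addsmxP[[c d] /= ->] := row_sub i (M + u)%MS.
  apply: linspaceD => //.
    by apply: (linspace_row sU UM); exact: submxMl.
  by apply: (@linspace_row _ _ u) => // [j|]; rewrite ?submxMl// row_id.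
rewrite leqNgt -rM => /negP[]; apply: rank_ltmx.
by rewrite /ltmx addsmxSl addsmx_sub submx_refl.
Qed.

Lemma dot_mulmx x (y : 'cV[R]_D) : (x *m y) 0 0 = dot x y^T.
Proof. by rewrite mxE; apply: eq_bigr => i _; rewrite mxE. Qed.

(** The inclusion of [(U^perp `&` W^perp)^perp] in [U + W]: the columns of a
    cokernel of [U + W] are orthogonal to both [U] and [W]. *)
Lemma orth_orthI_add U W x : linspace U -> linspace W ->
    (forall z, orth U z -> orth W z -> dot x z = 0) ->
  exists u w, [/\ U u, W w & x = u + w].
Proof.
move=> sU sW xUW; have [M UM] := linspace_mx sU; have [N WN] := linspace_mx sW.
have : (x <= M + N)%MS.
  rewrite submxE; apply/eqP/rowP => j.
  rewrite !mxE -[RHS](xUW (row j (cokermx (M + N)%MS)^T)).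
  - by apply: eq_bigr => i _; rewrite !mxE.
  - move=> w /UM wM; rewrite dotC -tr_col -dot_mulmx colE mulmxA.
    have /submxP[c ->] : (w <= M + N)%MS by rewrite (submx_trans wM)// addsmxSl.
    by rewrite -(mulmxA c) mulmx_coker mulmx0 mul0mx mxE.
  - move=> w /WN wN; rewrite dotC -tr_col -dot_mulmx colE mulmxA.
    have /submxP[c ->] : (w <= M + N)%MS by rewrite (submx_trans wN)// addsmxSr.
    by rewrite -(mulmxA c) mulmx_coker mulmx0 mul0mx mxE.
move=> /sub_addsmxP[[c d] /= ->].
by exists (c *m M), (d *m N); split=> //; [apply/UM|apply/WN]; exact: submxMl.
Qed.

(** [U] and [orth U] span: a vector of [orth U] that is orthogonal to [orth U]
    is orthogonal to itself. *)
Lemma orth_decomp U x : linspace U ->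
  exists u z, [/\ U u, orth U z & x = u + z].
Proof.
move=> sU; apply: orth_orthI_add => // [|z zU zz]; first exact: linspace_orth.
by have -> : z = 0; rewrite ?dot0r//; apply: dot_eq0; exact: zz.
Qed.
End Subspaces.

(** * The Friedrichs angle *)

Section FriedrichsAngle.
Context {R : realType} {D : nat}.
Implicit Types (u v w n p : 'rV[R]_D) (U W : set 'rV[R]_D).

Lemma cosFC U W : cosF U W = cosF W U.
Proof.
rewrite /cosF (setIC W U); congr sup; apply/seteqP.
by split=> _ [u Uu [w Ww <-]]; exists w => //; exists u => //; rewrite dotC.
Qed.

Lemma dot_le_cosF U W u w : linspace U -> linspace W ->
    (U `&` orth (U `&` W)) u -> (W `&` orth (U `&` W)) w ->
  dot u w <= cosF U W * (enorm u * enorm w).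
Proof.
move=> sU sW Uu Ww.
have [/enorm_eq0->|u0] := eqVneq (enorm u) 0.
  by rewrite /enorm !dotE sqrtr0 mul0r mulr0.
have [/enorm_eq0->|w0] := eqVneq (enorm w) 0.
  by rewrite /enorm !dotE sqrtr0 !mulr0.
have uw0 : 0 < enorm u * enorm w by rewrite mulr_gt0// lt_def ?u0 ?w0 enorm_ge0.
have sO := linspace_orth (U `&` W).
have unit V v : linspace V -> V v -> enorm v != 0 ->
    V ((enorm v)^-1 *: v) /\ enorm ((enorm v)^-1 *: v) <= 1.
  move=> sV Vv v0; split; first exact: (linspaceZ _ sV Vv).
  by rewrite enormZ ?invr_ge0 ?enorm_ge0// mulVf.
rewrite -ler_pdivrMr// invfM mulrC -mulrA mulrC -mulrA (mulrC (dot u w)).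
rewrite -dotZl -dotZr.
apply: ub_le_sup; last first.
  exists ((enorm u)^-1 *: u); first exact: unit (linspaceI sU sO) Uu u0.
  by exists ((enorm w)^-1 *: w) => //; exact: unit (linspaceI sW sO) Ww w0.
exists 1 => _ [v [_ v1] [v' [_ v'1] <-]].
rewrite (le_trans (dot_le_enorm _ _))//.
by rewrite -[leRHS]mulr1 ler_pM ?enorm_ge0.
Qed.

(** Let [p] in [U], orthogonal to [U `&` W], have the same component as [n']
    along [W^perp]; it exists since [n'] lies in [U + W].  Then
    [n' = p - w] with [w] the projection of [p] on [W], whose length is at
    most [c |p|], so that [(1 - c^2) |p|^2 <= |n'|^2]; and
    [(n + n') . p = n' . p = |n'|^2] gives the bound by Cauchy-Schwarz. *)
Lemma cosF_sqr_norm_add U W n n' : linspace U -> linspace W ->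
    orth U n -> orth W n' ->
    (forall h, orth U h -> orth W h -> dot n' h = 0) ->
  (1 - cosF U W ^+ 2) * dot n' n' <= dot (n + n') (n + n').
Proof.
move=> sU sW Un Wn' UWn'; set c := cosF U W.
have [c1|c1] := leP (1 - c ^+ 2) 0.
  by rewrite (le_trans _ (dot_ge0 _))// mulr_le0_ge0// dot_ge0.
have [p0 [w0 [Up0 Ww0 n'E]]] := orth_orthI_add sU sW UWn'.
have sUW := linspaceI sU sW.
have [p1 [p [[Up1 Wp1] pUW p0E]]] := orth_decomp p0 sUW.
have [w [z [Ww Wz pE]]] := orth_decomp p sW.
have Up : U p.
  by have -> : p = p0 - p1; [rewrite p0E addrC addKr|exact: linspaceB].
have n'z : n' = z.
  have Wn'z : W (n' - z).
    have -> : n' - z = p1 + w + w0.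
      by apply/rowP => i; rewrite n'E p0E pE !mxE; ring.
    by do 2?apply: linspaceD.
  apply/eqP; rewrite -subr_eq0; apply/eqP/dot_eq0.
  by rewrite {1}dotDl dotNl Wn'// Wz// subr0.
have wUW : orth (U `&` W) w.
  move=> t UWt; have := pUW t UWt.
  by rewrite pE dotDl (Wz t UWt.2) addr0.
have zw : dot z w = 0 by exact: Wz.
have pw : dot p w = dot w w by rewrite pE dotDl zw addr0.
have pp : dot p p = dot w w + dot z z.
  by rewrite pE !dotE (dotC w z) zw; lra.
have wc : dot w w <= c ^+ 2 * dot p p.
  have := dot_le_cosF sU sW (conj Up pUW) (conj Ww wUW).
  rewrite pw -/c -(sqr_enorm w) -(sqr_enorm p).
  have := enorm_ge0 w; have := enorm_ge0 p.
  move: (enorm w) (enorm p) => s t t0; rewrite le_eqVlt => /orP[/eqP<-|s0] h.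
    by rewrite expr0n mulr_ge0 ?sqr_ge0.
  have st : s <= c * t by rewrite -(ler_pM2r s0) -expr2 -mulrA.
  rewrite -exprMn lerXn2r ?nnegrE ?(ltW s0)//.
    exact: le_trans (ltW s0) st.
have up : dot (n + n') p = dot n' n'.
  by rewrite dotDl (Un p Up) add0r n'z pE dotDr zw add0r.
have := sqr_dot_le (n + n') p; rewrite up.
have := dot_ge0 (n + n'); have := dot_ge0 n'.
have : (1 - c ^+ 2) * dot p p <= dot n' n' by rewrite n'z; lra.
move: (dot n' n') (dot (n + n') _) (dot p p) (1 - c ^+ 2) c1.
move=> N S T k k0 kT; rewrite le_eqVlt => /orP[/eqP<-|N0] S0 NST.
  by rewrite mulr0.
rewrite -(ler_pM2r N0) -mulrA -expr2.
apply: (@le_trans _ _ (k * (S * T))); first by rewrite ler_wpM2l// ltW.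
by rewrite mulrCA ler_wpM2l.
Qed.

End FriedrichsAngle.

(** * Affine hulls *)

Section AffineHull.
Context {R : realType} {D : nat}.
Implicit Types (x y c : 'rV[R]_D) (C : set 'rV[R]_D).

Lemma subset_aff C : C `<=` aff C.
Proof.
move=> c Cc; exists 1%N, (fun=> 1), (fun=> c).
by split=> //; rewrite big_ord1// scale1r.
Qed.

Lemma aff_line C x y (t : R) :
  aff C x -> aff C y -> aff C (t *: x + (1 - t) *: y).
Proof.
move=> [m [l [f [Cf l1 ->]]]] [n [k [g [Cg k1 ->]]]].
pose mix T (p : 'I_m -> T) (q : 'I_n -> T) (i : 'I_(m + n)) :=
  match fintype.split i with inl j => p j | inr j => q j end.
have mixl T (p : 'I_m -> T) (q : 'I_n -> T) j : mix T p q (lshift n j) = p j.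
  by rewrite /mix; case: split_ordP => [i /lshift_inj->//|i /eqP];
     rewrite eq_lrshift.
have mixr T (p : 'I_m -> T) (q : 'I_n -> T) j : mix T p q (rshift m j) = q j.
  by rewrite /mix; case: split_ordP => [i /eqP|i /rshift_inj->//];
     rewrite eq_rlshift.
exists (m + n)%N, (mix R (fun j => t * l j) (fun j => (1 - t) * k j)).
exists (mix _ f g).
split.
- by move=> i; rewrite /mix; case: fintype.split.
- rewrite big_split_ord /=; under eq_bigr do rewrite mixl.
  under [X in _ + X]eq_bigr do rewrite mixr.
  by rewrite -!mulr_sumr l1 k1 !mulr1 addrC subrK.
- rewrite big_split_ord /=; under [in RHS]eq_bigr do rewrite !mixl.
  under [X in _ = _ + X]eq_bigr do rewrite !mixr.
  by rewrite !scaler_sumr; congr (_ + _); apply: eq_bigr => i _;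
     rewrite scalerA.
Qed.

Lemma linspace_aff0 C : C !=set0 -> linspace (aff0 C).
Proof.
move=> [c Cc]; rewrite (aff0E Cc).
have affc := subset_aff Cc; split; first by exists c; rewrite ?subrr.
move=> t _ _ [x affx <-] [y affy <-].
(* [t x + y - t c] is an affine combination, written here with two points at
   a time. *)
exists (2 *: (2^-1 *: (t *: x + (1 - t) *: c) + (1 - 2^-1) *: y)
        + (1 - 2) *: c).
  by do 3?apply: aff_line.
have h : 1 - 2^-1 = 2^-1 :> R by lra.
rewrite h; apply/rowP => i; rewrite !mxE; lra.
Qed.

Lemma mem_aff0 C x c : C x -> C c -> aff0 C (x - c).
Proof. by move=> Cx Cc; exists x; [exact: subset_aff|exists c]. Qed.

Lemma aff0_translate C c : aff0 [set x - c | x in C] = aff0 C.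
Proof.
have shift C' c' : aff0 C' `<=` aff0 [set x - c' | x in C'].
  move=> _ [_ [n [l [f [Cf l1 ->]]]] [d Cd <-]].
  exists (\sum_i l i *: f i - c'); last first.
    by exists (d - c'); [exists d|rewrite opprB addrA subrK].
  exists n, l, (fun i => f i - c'); split=> // [i|]; first by exists (f i).
  by rewrite -[c' in LHS]scale1r -l1 scaler_suml -sumrB;
     apply: eq_bigr => i _; rewrite scalerBr.
apply/seteqP; split; last exact: shift.
have := shift [set x - c | x in C] (- c).
suff -> : [set x - - c | x in [set x - c | x in C]] = C by [].
apply/seteqP; split=> [_ [_ [x Cx <-] <-]|x Cx]; first by rewrite opprK subrK.
by exists (x - c); [exists x|rewrite opprK subrK].
Qed.

End AffineHull.

(** * Faces of polyhedra *)

Section Faces.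
Context {R : realType} {D : nat}.
Implicit Types (x y z e d u n h : 'rV[R]_D) (A B : set 'rV[R]_D).

Definition hpoly (I : finType) (a : I -> 'rV[R]_D) (b : I -> R) :=
  [set x | forall i, dot (a i) x <= b i].

Lemma polyhedron_hpoly A : polyhedron A ->
  exists m (a : 'I_m -> 'rV[R]_D) (b : 'I_m -> R), A = hpoly a b.
Proof.
move=> [m [H [Hhs ->]]].
have /choice[a /choice[b Hab]] : forall i, exists a, exists b,
    H i = [set x | dot a x <= b].
  by move=> i; have [a [b [_ ->]]] := Hhs i; exists a, b.
exists m, a, b; apply/seteqP; split=> [x Hx i|x abx i _].
  by have := Hx i Logic.I; rewrite Hab.
by rewrite Hab; exact: abx.
Qed.

Lemma closed_hpoly (I : finType) (a : I -> 'rV[R]_D) b : closed (hpoly a b).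
Proof.
have -> : hpoly a b = \bigcap_i [set x | dot (a i) x <= b i].
  by apply/seteqP; split=> [x Hx i _|x Hx i]; [exact: Hx|exact: (Hx i Logic.I)].
by apply: closed_bigI => i _; exact: closed_dot_le.
Qed.

Lemma hpoly_segment (I : finType) (a : I -> 'rV[R]_D) b x y t :
  0 <= t <= 1 -> hpoly a b x -> hpoly a b y -> hpoly a b (x + t *: (y - x)).
Proof.
move=> /andP[t0 t1] Ax Ay i; have := Ax i; have := Ay i; rewrite !dotE.
by move: (dot _ _) (dot _ _) => *; nra.
Qed.

Lemma hpolyI (I J : finType) (a : I -> 'rV[R]_D) b (a' : J -> 'rV[R]_D) b' :
  hpoly a b `&` hpoly a' b' =
  hpoly (fun k : I + J => match k with inl i => a i | inr j => a' j end)
        (fun k => match k with inl i => b i | inr j => b' j end).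
Proof.
apply/seteqP; split=> [x [Ax Bx] [i|j]//|x ABx].
by split=> i; [have := ABx (inl i)|have := ABx (inr i)].
Qed.

Lemma hpoly_feasible (I : finType) (a : I -> 'rV[R]_D) b e d : hpoly a b e ->
    (forall i, dot (a i) e == b i -> dot (a i) d <= 0) ->
  exists2 t, 0 < t & hpoly a b (e + t *: d).
Proof.
move=> Ae Hd.
pose g i := b i - dot (a i) e; have g0 i : 0 <= g i by rewrite subr_ge0 Ae.
(* The sum bounds the rate of each slack constraint relative to its gap; for a
   tight constraint the division by zero contributes [0]. *)
pose s := 1 + \sum_i `|dot (a i) d| / g i.
have f0 i : 0 <= `|dot (a i) d| / g i by rewrite divr_ge0.
have s0 : 0 < s by rewrite ltr_wpDr// sumr_ge0.
exists s^-1; rewrite ?invr_gt0// => i; rewrite dotDr dotZr.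
have [ei|ni] := boolP (dot (a i) e == b i).
  by rewrite (eqP ei) gerDl pmulr_rle0 ?invr_gt0// Hd.
have gi : 0 < g i by rewrite lt_def g0 subr_eq0 eq_sym ni.
rewrite addrC -lerBrDr -/(g i) mulrC ler_pdivrMr// mulrC.
rewrite (le_trans (ler_norm _))// -ler_pdivrMr// /s (bigD1 i)//= addrCA lerDl.
by rewrite addr_ge0// sumr_ge0.
Qed.

Lemma faceD A n n' e : face A n e -> face A n' e -> face A (n + n') e.
Proof.
move=> [Ae An] [_ An']; split=> // z Az.
by rewrite !dotDl lerD ?An ?An'.
Qed.

Lemma faceZ A n e (t : R) : 0 <= t -> face A n e -> face A (t *: n) e.
Proof.
by move=> t0 [Ae An]; split=> // z Az; rewrite !dotZl ler_wpM2l// An.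
Qed.

(** A direction that satisfies the constraints tight at [e] is feasible, so
    that [u] cannot increase along it: this is the hypothesis of Farkas'
    lemma. *)
Lemma face_farkas (I : finType) (a : I -> 'rV[R]_D) b u e :
    face (hpoly a b) u e ->
  exists2 l : I -> R, forall i, 0 <= l i &
    u = \sum_(i | dot (a i) e == b i) l i *: a i.
Proof.
move=> [Ae Hu].
pose tight i := dot (a i) e == b i.
have [d Hd|l [l0 ul]] := @farkas _ _ _ tight a u; last first.
  by exists l.
have [t t0 At] := hpoly_feasible Ae Hd.
by have := Hu _ At; rewrite dotDr dotZr gerDl pmulr_rle0.
Qed.

Lemma face_tight_sum (I : finType) (a : I -> 'rV[R]_D) b l e :
    hpoly a b e -> (forall i, 0 <= l i) ->
  face (hpoly a b) (\sum_(i | dot (a i) e == b i) l i *: a i) e.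
Proof.
move=> Ae l0; split=> // z Az; rewrite !dot_suml.
apply: ler_sum => i /eqP ei; rewrite !dotZl ler_wpM2l// ei; exact: Az.
Qed.

(** By [face_farkas] at a point [e] of the face, [u . e - u . x] is a
    nonnegative combination of the gaps [b i - a i . x]; it vanishes exactly if
    the constraints with positive multipliers are tight at [x]. *)
Lemma face_tight (I : finType) (a : I -> 'rV[R]_D) b u :
    face (hpoly a b) u !=set0 ->
  exists S : {set I}, face (hpoly a b) u =
    [set x | hpoly a b x /\ forall i, i \in S -> dot (a i) x = b i].
Proof.
move=> [e uAe]; have Ae := uAe.1; have [l l0 ul] := face_farkas uAe.
exists [set i | (dot (a i) e == b i) && (0 < l i)]%SET.
have gap x : dot u e - dot u x =
    \sum_(i | dot (a i) e == b i) l i * (b i - dot (a i) x).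
  rewrite ul !dot_suml -sumrB; apply: eq_bigr => i /eqP <-.
  by rewrite !dotZl mulrBr.
apply/seteqP; split=> x [Ax Hx]; split=> //.
  move=> i; rewrite inE => /andP[ei li].
  have term0 j : dot (a j) e == b j -> 0 <= l j * (b j - dot (a j) x).
    by move=> _; rewrite mulr_ge0// subr_ge0 Ax.
  have : dot u e - dot u x = 0.
    by apply/eqP; rewrite subr_eq0 eq_le Hx// uAe.2.
  rewrite gap => /(psumr_eq0P term0) /(_ i ei) /eqP.
  by rewrite mulf_eq0 (gt_eqF li) /= subr_eq0 => /eqP.
move=> z Az; rewrite (le_trans (uAe.2 z Az))// -subr_le0 gap big1// => i ei.
have := l0 i; rewrite le_eqVlt => /orP[/eqP<-|li]; first by rewrite mul0r.
by rewrite Hx ?subrr ?mulr0// inE ei.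
Qed.

(** The constraints of both polyhedra are pooled, and the multipliers given by
    Farkas' lemma are sorted by origin. *)
Lemma face_hpolyI (I J : finType) (a : I -> 'rV[R]_D) b (a' : J -> 'rV[R]_D) b'
    u e :
    face (hpoly a b `&` hpoly a' b') u e ->
  exists n n', [/\ face (hpoly a b) n e, face (hpoly a' b') n' e & u = n + n'].
Proof.
move=> H; have [Ae Be] := H.1.
move: H; rewrite hpolyI => /face_farkas[l l0]; rewrite big_sumType /= => ->.
exists (\sum_(i | dot (a i) e == b i) l (inl i) *: a i).
exists (\sum_(j | dot (a' j) e == b' j) l (inr j) *: a' j).
by split=> //; apply: (@face_tight_sum _ _ _ (fun _ => l _)).
Qed.

(** [n] lies in the relative interior of the cone of normals of the face it
    exposes, a cone that spans the orthogonal complement of the face.  That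
    face is cut out of the polyhedron by one more inequality, with normal
    [- n], and [h] is constant on it; so [h] is the sum of a normal of the
    polyhedron and a multiple of [- n]. *)
Lemma face_relint (I : finType) (a : I -> 'rV[R]_D) b n h e :
    face (hpoly a b) n e -> orth (aff0 (face (hpoly a b) n)) h ->
  exists2 k0 : R, 0 <= k0 &
    forall k, k0 <= k -> face (hpoly a b) (k *: n + h) e.
Proof.
set A := hpoly a b => nAe nAh.
pose c (_ : unit) := - n; pose d (_ : unit) := - dot n e.
have : face (A `&` hpoly c d) h e.
  have Be : hpoly c d e by move=> i; rewrite dotNl.
  split=> [|z [Az /(_ tt)]]; first by split=> //; exact: nAe.1.
  rewrite dotNl lerN2 => nez.
  have nAz : face A n z by split=> // y Ay; rewrite (le_trans _ nez)// nAe.2.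
  have := nAh _ (mem_aff0 nAz nAe); rewrite dotDr dotNr => /eqP.
  by rewrite subr_eq0 => /eqP->.
move=> /face_hpolyI[n1 [n2 [An1 /face_farkas[l l0 n2E] ->]]].
have {n2E} [s s0 ->] : exists2 s, 0 <= s & n2 = - (s *: n).
  exists (\sum_(i | dot (c i) e == d i) l i); first exact: sumr_ge0.
  by rewrite n2E scaler_suml -sumrN; apply: eq_bigr => i _; rewrite scalerN.
exists s => // k sk.
rewrite addrC -addrA (addrC (- _)) -scalerBl.
by apply: faceD => //; apply: faceZ => //; rewrite subr_ge0.
Qed.

End Faces.

(** * Distance to the intersection of two polyhedra *)

Section Distance.
Context {R : realType} {D : nat}.
Implicit Types (x y z e : 'rV[R]_D) (A B : set 'rV[R]_D).

Lemma set_dist_le A B x y : A x -> B y -> set_dist A B <= enorm (x - y).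
Proof.
move=> Ax By; apply: ge_inf; last by exists x => //; exists y.
by exists 0 => _ [? _ [? _ <-]]; exact: enorm_ge0.
Qed.

Lemma le_set_dist A B (r : R) : A !=set0 -> B !=set0 ->
  (forall x y, A x -> B y -> r <= enorm (x - y)) -> r <= set_dist A B.
Proof.
move=> [x Ax] [y By] H; apply: lb_le_inf.
  by exists (enorm (x - y)), x => //; exists y.
by move=> _ [x' Ax' [y' By' <-]]; exact: H.
Qed.

Lemma pt_dist_le A x y : A y -> pt_dist x A <= enorm (x - y).
Proof. exact: set_dist_le. Qed.

Lemma le_pt_dist A x (r : R) : A !=set0 ->
  (forall y, A y -> r <= enorm (x - y)) -> r <= pt_dist x A.
Proof.
by move=> A0 H; apply: le_set_dist => // [|_ y ->]; [exists x|exact: H].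
Qed.

Lemma pt_dist_set0 x : pt_dist x set0 = 0.
Proof.
rewrite /pt_dist /set_dist -[RHS]inf0; congr inf.
by apply/seteqP; split=> // _ [_ _ [_ []]].
Qed.

Lemma pt_dist_ge0 A x : 0 <= pt_dist x A.
Proof.
have [->|/set0P A0] := eqVneq A set0; first by rewrite pt_dist_set0.
by apply: le_pt_dist => // y _; exact: enorm_ge0.
Qed.

Lemma orth_aff0_face A n : orth (aff0 (face A n)) n.
Proof.
move=> _ [_ [m [l [f [Ff l1 ->]]]] [c Fc <-]].
rewrite dotDr dotNr (dotC n (\sum_i _)) dot_suml.
rewrite (eq_bigr (fun i => l i * dot n c)) => [|i _].
  by rewrite -mulr_suml l1 mul1r subrr.
rewrite dotZl (dotC (f i)); congr (_ * _).
have [[Ai Ni] [Ac Nc]] := (Ff i, Fc).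
by apply/eqP; rewrite eq_le Nc// Ni.
Qed.

Lemma closed_face_pair A B u e : A e -> B e ->
  closed [set w | face B w e /\ face A (u - w) e].
Proof.
move=> Ae Be.
have -> : [set w | face B w e /\ face A (u - w) e] =
    \bigcap_(z in B) [set w | dot (z - e) w <= 0] `&`
    \bigcap_(z in A) [set w | dot (e - z) w <= dot (e - z) u].
  apply/seteqP; split=> w /=.
    move=> [[_ Bw] [_ Aw]]; split=> z Kz /=.
      by have := Bw z Kz; rewrite !dotE !(dotC w); lra.
    by have := Aw z Kz; rewrite !dotE !(dotC w) !(dotC u); lra.
  move=> [Bw Aw]; split; split=> // z Kz.
    by have := Bw z Kz; rewrite /= !dotE !(dotC w); lra.
  by have := Aw z Kz; rewrite /= !dotE !(dotC w) !(dotC u); lra.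
by apply: closedI; apply: closed_bigI => z _; exact: closed_dot_le.
Qed.

(** Among the decompositions of the normal [u] into normals to [A] and to [B]
    at [e], given by [face_hpolyI], the one with [n'] shortest is taken: a
    vector [h] orthogonal to both exposed faces can be shifted in small
    amounts, of either sign, between [n] and [n'], so that [n'] is orthogonal
    to [h]. *)
Lemma normal_decomposition (I J : finType) (a : I -> 'rV[R]_D) b
    (a' : J -> 'rV[R]_D) b' u e :
    let A := hpoly a b in let B := hpoly a' b' in
    face (A `&` B) u e ->
  exists n n', [/\ face A n e, face B n' e, u = n + n' &
    forall h, orth (aff0 (face A n)) h -> orth (aff0 (face B n')) h ->
      dot n' h = 0].
Proof.
move=> A B ABu; have [Ae Be] := ABu.1.
pose K := [set w | face B w e /\ face A (u - w) e].
have K0 : K !=set0.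
  have [n [n' [An Bn' un]]] := face_hpolyI ABu.
  by exists n'; split=> //; rewrite un addrK.
have cK : closed K := closed_face_pair Ae Be.
have [n' [Bn' An] n'min] := nearest_point 0 cK K0.
have Kseg w t : K w -> 0 <= t <= 1 -> K (n' + t *: (w - n')).
  move=> [Bw Aw] /andP[t0 t1].
  have t1' : 0 <= 1 - t by rewrite subr_ge0.
  split.
    have -> : n' + t *: (w - n') = (1 - t) *: n' + t *: w.
      by apply/rowP => i; rewrite !mxE; ring.
    by apply: faceD; exact: faceZ.
  have -> : u - (n' + t *: (w - n')) = (1 - t) *: (u - n') + t *: (u - w).
    by apply/rowP => i; rewrite !mxE; ring.
  by apply: faceD; exact: faceZ.
exists (u - n'), n'; split=> //; first by rewrite subrK.
have ge0 h : orth (aff0 (face A (u - n'))) h -> orth (aff0 (face B n')) h ->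
    0 <= dot n' h.
  move=> Ah Bh.
  have ANh : orth (aff0 (face A (u - n'))) (- h).
    exact: linspaceN (linspace_orth _) Ah.
  have [k1 k10 Hk1] := face_relint An ANh.
  have [k2 k20 Hk2] := face_relint Bn' Bh.
  pose k := k1 + k2 + 1.
  have k0 : 0 < k by rewrite /k; lra.
  have kV : k^-1 * k = 1 by rewrite mulVf// gt_eqF.
  have Kw : K (n' + k^-1 *: h).
    split.
      have -> : n' + k^-1 *: h = k^-1 *: (k *: n' + h).
        by rewrite scalerDr scalerA kV scale1r.
      by apply: faceZ; [rewrite invr_ge0 ltW|apply: Hk2; rewrite /k; lra].
    have -> : u - (n' + k^-1 *: h) = k^-1 *: (k *: (u - n') - h).
      by rewrite scalerBr scalerA kV scale1r opprD addrA.
    by apply: faceZ; [rewrite invr_ge0 ltW|apply: Hk1; rewrite /k; lra].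
  have := nearest_obtuse (fun t => Kseg _ t Kw) n'min.
  rewrite sub0r [_ + _ - n']addrC addKr dotNl dotZr oppr_le0.
  by rewrite pmulr_rge0// invr_gt0.
move=> h Ah Bh; apply/eqP; rewrite eq_le ge0// andbT -oppr_ge0 -dotNr.
by apply: ge0; [exact: linspaceN (linspace_orth _) Ah|
                exact: linspaceN (linspace_orth _) Bh].
Qed.

(** Write [x - e = n + n'] as in [normal_decomposition].  Since [x] is in
    [A], [n . (x - e) <= 0], so [|x - e|^2 <= n' . (x - e)], which is at most
    [|n'| d(x, B)]; and [cosF_sqr_norm_add] bounds [|n'|] by [|x - e|]. *)
Lemma sqr_pt_dist_cap (I J : finType) (a : I -> 'rV[R]_D) b
    (a' : J -> 'rV[R]_D) b' x :
    let A := hpoly a b in let B := hpoly a' b' in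
    A `&` B !=set0 -> A x ->
  exists n n', [/\ face A n !=set0, face B n' !=set0 &
    (1 - cosF (aff0 (face A n)) (aff0 (face B n')) ^+ 2) *
      pt_dist x (A `&` B) ^+ 2 <= pt_dist x B ^+ 2].
Proof.
move=> A B AB0 Ax.
have cAB : closed (A `&` B) by apply: closedI; exact: closed_hpoly.
have [e [Ae Be] emin] := nearest_point x cAB AB0.
set u := x - e.
have ABu : face (A `&` B) u e.
  split=> // z [Az Bz]; rewrite -subr_le0 -dotNr -dotDr.
  by apply: nearest_obtuse emin => t t01; split; exact: hpoly_segment.
have [n [n' [An Bn' un n'h]]] := normal_decomposition ABu.
exists n, n'; split; [by exists e|by exists e|].
set c := cosF _ _; set beta := pt_dist x B.
have cn' : (1 - c ^+ 2) * dot n' n' <= dot u u.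
  rewrite un; apply: cosF_sqr_norm_add => //; try exact: orth_aff0_face.
    by apply: linspace_aff0; exists e.
  by apply: linspace_aff0; exists e.
have un' y : B y -> dot u u <= enorm n' * enorm (x - y).
  move=> By; apply: le_trans (dot_le_enorm _ _).
  have := An.2 x Ax; have := Bn'.2 y By.
  by rewrite {1}un /u !dotE; lra.
have beta0 : 0 <= beta := pt_dist_ge0 _ _.
have {}un' : dot u u <= enorm n' * beta.
  have := enorm_ge0 n'; rewrite le_eqVlt => /orP[/eqP n'0|n'0].
    by have := un' e Be; rewrite -n'0 !mul0r.
  rewrite mulrC -ler_pdivrMr//; apply: le_pt_dist; first by exists e.
  by move=> y By; rewrite ler_pdivrMr// mulrC un'.
have [c1|c1] := leP (1 - c ^+ 2) 0.
  by rewrite (le_trans _ (sqr_ge0 _))// mulr_le0_ge0// sqr_ge0.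
apply: (@le_trans _ _ ((1 - c ^+ 2) * dot u u)).
  rewrite ler_wpM2l ?(ltW c1)// -sqr_enorm lerXn2r// ?nnegrE ?pt_dist_ge0//.
    exact: enorm_ge0.
  exact: pt_dist_le.
move: cn' un' (dot_ge0 u); rewrite -(sqr_enorm n').
move: (dot u u) (enorm n') (1 - c ^+ 2) c1 => U N k k0 kN UN.
rewrite le_eqVlt => /orP[/eqP<-|U0]; first by rewrite mulr0 sqr_ge0.
rewrite -(ler_pM2r U0) -mulrA -expr2.
apply: (@le_trans _ _ (k * (N * beta) ^+ 2)).
  by rewrite ler_wpM2l ?(ltW k0)// lerXn2r// nnegrE ltW// (lt_le_trans U0).
by rewrite exprMn mulrA mulrC ler_wpM2l// sqr_ge0.
Qed.

End Distance.

(** * Nearest points of two polyhedra *)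

Section NearestPairs.
Context {R : realType} {D : nat}.
Implicit Types (x y p q v : 'rV[R]_D) (A P Q : set 'rV[R]_D).

(** Two vectors of least norm in a set coincide if the set contains their
    midpoint, by the parallelogram identity. *)
Lemma min_norm_unique v w : enorm v = enorm w ->
  enorm v <= enorm (2^-1 *: (v + w)) -> v = w.
Proof.
move=> vw; rewrite ler_enorm !dotE (dotC w v) => h.
have {}vw : dot v v = dot w w by rewrite -!sqr_enorm vw.
apply/eqP; rewrite -subr_eq0; apply/eqP/dot_eq0/eqP.
rewrite eq_le dot_ge0 andbT !dotE (dotC w v); lra.
Qed.

Lemma translate_hpoly (I : finType) (a : I -> 'rV[R]_D) b v :
  [set x - v | x in hpoly a b] = hpoly a (fun i => b i - dot (a i) v).
Proof.
apply/seteqP; split=> [_ [x Ax <-] i|x Ax]; first by rewrite dotDr dotNr lerB.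
by exists (x + v); [move=> i; rewrite dotDr -lerBrDr|rewrite addrK].
Qed.

Lemma translate_face A v y :
  face [set x - v | x in A] y = [set x - v | x in face A y].
Proof.
apply/seteqP; split=> [_ [[x Ax <-] H]|_ [x [Ax H] <-]].
  exists x => //; split=> // z Az.
  by have := H (z - v) (ex_intro2 _ _ z Az erefl); rewrite !dotDr lerD2r.
by split=> [|_ [z Az <-]]; [exists x|rewrite !dotDr lerD2r H].
Qed.

(** If [p0] is in [E], it has a nearest point [q0] in [Q], and [q0 - p0] is
    an element of least norm of [Q - P]; so the gap vector [v] is a genuine
    minimizer.  By uniqueness, a point [p] of [P] is in [E] exactly if
    [q - p = v] for some [q] in [Q]. *)
Lemma nearest_pts_shifted (I J : finType) (a : I -> 'rV[R]_D) b
    (a' : J -> 'rV[R]_D) b' :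
    let P := hpoly a b in let Q := hpoly a' b' in
    Q !=set0 -> nearest_pts P Q !=set0 ->
  nearest_pts P Q = P `&` shifted P Q.
Proof.
move=> P Q Q0 [p0 [Pp0 p0Q]].
have attained p : exists2 q, Q q & enorm (q - p) = pt_dist p Q.
  have [q Qq qmin] := nearest_point p (@closed_hpoly _ _ _ a' b') Q0.
  exists q => //; apply/eqP; rewrite enormB eq_le pt_dist_le// andbT.
  exact: le_pt_dist.
have dist_le p q : P p -> Q q -> set_dist P Q <= enorm (q - p).
  by move=> Pp Qq; rewrite enormB; exact: set_dist_le.
set v := gap_vec P Q.
have [[q1 Qq1 [p1 Pp1 vE]] vmin] : [set q - p | q in Q & p in P] v /\
    forall z, [set q - p | q in Q & p in P] z -> enorm (0 - v) <= enorm (0 - z).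
  apply: (xgetPex 0 (P := [set y | _ y /\ _])).
  have [q0 Qq0 q0E] := attained p0.
  exists (q0 - p0); split; first by exists q0 => //; exists p0.
  move=> _ [q Qq [p Pp <-]].
  by rewrite !sub0r !enormN q0E p0Q dist_le.
have {}vmin p q : P p -> Q q -> enorm v <= enorm (q - p).
  move=> Pp Qq; have := vmin (q - p); rewrite !sub0r !enormN; apply.
  by exists q => //; exists p.
have vdist : enorm v = set_dist P Q.
  have [q0 Qq0 q0E] := attained p0.
  apply/eqP; rewrite eq_le -{1}p0Q -q0E vmin//=.
  by rewrite -vE dist_le.
have half : 0 <= (2^-1 : R) <= 1 by apply/andP; split; lra.
apply/seteqP; split=> p.
  move=> [Pp pQ]; split=> //; have [q Qq qE] := attained p; exists q => //.
  suff vqp : q - p = v by rewrite -/v -vqp subKr.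
  apply/esym/min_norm_unique; first by rewrite qE pQ.
  have -> : 2^-1 *: (v + (q - p)) =
      (q1 + 2^-1 *: (q - q1)) - (p1 + 2^-1 *: (p - p1)).
    by rewrite -vE; apply/rowP => i; rewrite !mxE; lra.
  by apply: vmin; exact: hpoly_segment.
move=> [Pp [q Qq pE]]; split=> //.
apply/eqP; rewrite eq_le; apply/andP; split.
  rewrite -vdist -[v](_ : q - p = v); last by rewrite -pE subKr.
  by rewrite enormB; exact: pt_dist_le.
by apply: le_pt_dist => // y Qy; exact: set_dist_le.
Qed.

(** * The condition number *)

Lemma kappa_ge0 P Q x : 0 <= kappa P Q x.
Proof. by rewrite divr_ge0 ?le_max ?pt_dist_ge0. Qed.

Lemma sqr_kappa_le P Q x (k r : R) : 0 <= r ->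
    r <= Num.max (pt_dist x P) (pt_dist x (shifted P Q)) ->
    k * pt_dist x (nearest_pts P Q) ^+ 2 <= r ^+ 2 ->
  k * kappa P Q x ^+ 2 <= 1.
Proof.
move=> r0; rewrite /kappa; set m := Num.max _ _ => rm kr.
have [->|m0] := eqVneq m 0; first by rewrite invr0 mulr0 expr0n mulr0.
have {}m0 : 0 < m by rewrite lt_def m0 (le_trans r0).
rewrite expr_div_n mulrA ler_pdivrMr ?exprn_gt0// mul1r (le_trans kr)//.
by rewrite lerXn2r// nnegrE// ltW.
Qed.

(** If [E] is empty, the distance to [E] is the infimum of the empty set,
    which is [0], so that [kappa] vanishes.  Otherwise this is
    [sqr_pt_dist_cap], with the roles of [P] and [Q'] exchanged when [x] lies
    in [Q']. *)
Lemma face_kappa (P Q : set 'rV[R]_D) x :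
    polyhedron P -> polyhedron Q -> P !=set0 -> Q !=set0 ->
    kappa_dom P Q x ->
  exists y z, [/\ face P y !=set0, face Q z !=set0 &
    (1 - cosF (aff0 (face P y)) (aff0 (face Q z)) ^+ 2) *
      kappa P Q x ^+ 2 <= 1].
Proof.
move=> /polyhedron_hpoly[m [a [b ->]]] /polyhedron_hpoly[m' [a' [b' ->]]].
set P' := hpoly a b; set Q' := hpoly a' b' => P0 Q0 [PQx _].
have [E0|/set0P E0] := eqVneq (nearest_pts P' Q') set0.
  have [p Pp] := P0; have [q Qq] := Q0; exists 0, 0; split.
  - by exists p; split=> // z _; rewrite !dot0l.
  - by exists q; split=> // z _; rewrite !dot0l.
  - by rewrite /kappa E0 pt_dist_set0 mul0r expr0n mulr0.
have EE := nearest_pts_shifted Q0 E0.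
have shiftE := translate_hpoly a' b' (gap_vec P' Q').
have aff0_shift z : aff0 (face (shifted P' Q') z) = aff0 (face Q' z).
  by rewrite /shifted translate_face aff0_translate.
have face0 z : face (shifted P' Q') z !=set0 -> face Q' z !=set0.
  by rewrite /shifted translate_face => -[_ [q Fq _]]; exists q.
have cap0 : P' `&` shifted P' Q' !=set0 by rewrite -EE.
case: PQx => [Px|Qx].
  move: cap0; rewrite /shifted shiftE => cap0.
  have [y [z [Fy Fz]]] := sqr_pt_dist_cap cap0 Px.
  rewrite -shiftE -EE aff0_shift => h; exists y, z; split=> //.
    by apply: face0; rewrite /shifted shiftE.
  apply: sqr_kappa_le h; first exact: pt_dist_ge0.
  by rewrite le_max lexx orbT.
move: Qx cap0; rewrite setIC /shifted shiftE => Qx cap0.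
have [z [y [Fz Fy]]] := sqr_pt_dist_cap cap0 Qx.
rewrite -shiftE setIC -EE aff0_shift cosFC => h; exists y, z; split=> //.
  by apply: face0; rewrite /shifted shiftE.
apply: sqr_kappa_le h; first exact: pt_dist_ge0.
by rewrite le_max lexx.
Qed.

(** For [M < 1] the hypothesis bounds [kappa], and so its supremum, by
    [(1 - M)^(-1/2)]; this rules out an infinite supremum.  For [1 <= M] the
    bound holds whatever the supremum, because the inverse of its square is
    nonnegative. *)
Lemma kappa_star_le P Q (M : R) : 0 <= M ->
    (forall x, kappa_dom P Q x -> (1 - M) * kappa P Q x ^+ 2 <= 1) ->
  (1 - (kappa_star P Q ^+ 2)^-1 <= M%:E)%E.
Proof.
move=> M0 H; rewrite /kappa_star; have [_|/set0P[x0 x0dom]] := eqVneq.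
  by rewrite expe2 mule1 inve1 subee.
set s := ereal_sup _.
have s0 : (0 <= s)%E.
  apply: (@le_trans _ _ (kappa P Q x0)%:E); first by rewrite lee_fin kappa_ge0.
  by apply: ereal_sup_ubound; exists x0.
have [M1|M1] := leP 1 M.
  apply: (@le_trans _ _ 1%E); last by rewrite lee_fin.
  by rewrite -[leRHS]sube0; apply: leeB => //; rewrite inve_ge0 expe_ge0.
have {}M1 : 0 < 1 - M by rewrite subr_gt0.
pose k := Num.sqrt (1 - M)^-1.
have k2 : k ^+ 2 = (1 - M)^-1 by rewrite sqr_sqrtr// invr_ge0 ltW.
have sk : (s <= k%:E)%E.
  apply: ge_ereal_sup => _ [x xdom <-]; rewrite lee_fin.
  rewrite -(@ler_pXn2r _ 2)// ?nnegrE ?kappa_ge0 ?sqrtr_ge0//.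
  by rewrite k2 -[leRHS]mul1r ler_pdivlMr// mulrC H.
have : s \is a fin_num by rewrite ge0_fin_numE// (le_lt_trans sk)// ltry.
move: s s0 sk => [r| |]//; rewrite !lee_fin => r0 rk _.
rewrite -EFin_expe inver; case: eqP => [_|/eqP r2].
  (* The inverse of [0] is [+oo], so the left-hand side is [-oo]. *)
  by rewrite /= leNye.
rewrite -EFinB lee_fin lerBlDr addrC -lerBlDr -[leLHS]invrK lef_pV2 ?posrE.
- by rewrite -k2 lerXn2r// nnegrE sqrtr_ge0.
- by rewrite invr_gt0.
- by rewrite lt_def r2 sqr_ge0.
Qed.

End NearestPairs.

Lemma is_max_fin (R : realType) (T : finType) (f : T -> R) (S : set R) :
    S !=set0 -> (forall z, S z -> exists t, z = f t) ->
  exists M, is_max S M.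
Proof.
move=> [z0 Sz0] Sf; have [t0 z0E] := Sf z0 Sz0.
have P0 : `[< S (f t0) >] by apply/asboolP; rewrite -z0E.
have [t /asboolP St tmax] := arg_maxP (P := fun t => `[< S (f t) >]) f P0.
exists (f t); split=> // z Sz; have [t' z'E] := Sf z Sz.
by rewrite z'E; apply: tmax; apply/asboolP; rewrite -z'E.
Qed.

Unset Implicit Arguments.
Set Strict Implicit.

Theorem corollary5 (R : realType) (D : nat) (P Q : set 'rV[R]_D)
    (polyP : polyhedron P) (polyQ : polyhedron Q)
    (P0 : P !=set0) (Q0 : Q !=set0) :
  exists M : R,
    is_max [set z | exists x y : 'rV[R]_D,
                [/\ face P x !=set0, face Q y !=set0 &
                    z = cosF (aff0 (face P x)) (aff0 (face Q y)) ^+ 2]] M /\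
    (1 - (kappa_star P Q ^+ 2)^-1 <= M%:E)%E.
Proof.
set S := [set z | _].
have [M SM] : exists M, is_max S M.
  have [m [a [b PE]]] := polyhedron_hpoly polyP.
  have [m' [a' [b' QE]]] := polyhedron_hpoly polyQ.
  pose F A n (c : 'I_n -> 'rV[R]_D) d (T : {set 'I_n}) : set 'rV[R]_D :=
    [set x | A x /\ forall i, i \in T -> dot (c i) x = d i].
  pose f (T : {set 'I_m} * {set 'I_m'}) :=
    cosF (aff0 (F P m a b T.1)) (aff0 (F Q m' a' b' T.2)) ^+ 2.
  apply: (is_max_fin (f := f)).
    have [p Pp] := P0; have [q Qq] := Q0.
    exists (cosF (aff0 (face P 0)) (aff0 (face Q 0)) ^+ 2), 0, 0.
    by split=> //; [exists p|exists q]; split=> // z _; rewrite !dot0l.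
  move=> z [x [y [Fx Fy ->]]].
  have [T1 TE1] : exists T, face P x = F P m a b T.
    by rewrite /F PE; apply: face_tight; rewrite -PE.
  have [T2 TE2] : exists T, face Q y = F Q m' a' b' T.
    by rewrite /F QE; apply: face_tight; rewrite -QE.
  by exists (T1, T2); rewrite /f -TE1 -TE2.
have [[x [y [_ _ ME]]] Mub] := SM.
exists M; split=> //; apply: kappa_star_le => [|z zdom].
  by rewrite ME sqr_ge0.
have [x' [y' [Fx Fy h]]] := face_kappa polyP polyQ P0 Q0 zdom.
apply: le_trans h; rewrite ler_wpM2r ?sqr_ge0// lerB//.
by apply: Mub; exists x', y'.
Qed.
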